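(* For every monomial $w\in\mathfrak M(\mathcal T)$ and every $i\ge 1$, $$\partial_i w(t)=\sum_{s\in\Lambda_w^{-1}(t_i)}t^{\hslash(s)},$$ where $\Lambda_w^{-1}(t_i)$ is the set of leaves labelled $t_i$ in the rooted binary tree $\Psi(w)$ associated with $w$, and $\hslash(s)$ is the height of the leaf $s$.
   Context: $K$ is a commutative field of characteristic $\ne2$. $\mathcal T=\{t_n : n\ge1\}$ is a countable set of letters, $\mathfrak M(\mathcal T)$ is the set of commutative nonassociative monomials in $\mathcal T$ (the free commutative magma), and $K(\mathcal T)$ is the free commutative nonassociative (non-unital) $K$-algebra with basis $\mathfrak M(\mathcal T)$. For $i\ge1$, $\partial_i:K(\mathcal T)\to K[t]$ is the linear map with $\partial_i(t_i)=1$, $\partial_i(t_j)=0$ for $j\ne i$, and $\partial_i(uv)=t\,(\partial_i(u)+\partial_i(v))$ for all monomials $u,v$. To a monomial $w$ is associated a rooted binary tree $\Psi(w)$ with leaves labelled by $\mathcal T$, up to isomorphism of labelled rooted trees: $\Psi(t_j)$ is the single-vertex tree (its root is also its only leaf) labelled $t_j$, and $\Psi(uv)$ is the grafting of $\Psi(u)$ and $\Psi(v)$, i.e. the tree with a new root joined by two edges to the roots of $\Psi(u)$ and $\Psi(v)$. The height $\hslash(s)$ of a vertex $s$ is the number of edges of the path from $s$ to the root. An empty sum is $0$. *)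

(* Defs.v *)
From HB Require Import structures.
From mathcomp Require Import all_boot all_order all_algebra.
From mathcomp Require Import finmap.
From mathcomp.multinomials Require Import monalg.

Set Implicit Arguments.
Unset Strict Implicit.
Unset Printing Implicit Defensive.

Import GRing.Theory.

Local Open Scope ring_scope.
Local Open Scope quotient_scope.

(* The number n stands for the letter t_n. *)
Definition letter := {n : nat | (0 < n)%N}.

(* The free magma; [monomial] is its quotient by commutativity. *)
Inductive term := Letter of letter | Node of term & term.

Fixpoint encode_term t : GenTree.tree letter :=
  match t with
  | Letter j => GenTree.Leaf j
  | Node u v => GenTree.Node 0 [:: encode_term u; encode_term v]
  end.

Fixpoint decode_term (t : GenTree.tree letter) : option term :=
  match t with
  | GenTree.Leaf j => Some (Letter j)
  | GenTree.Node _ [:: u; v] =>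
      if (decode_term u, decode_term v) is (Some u', Some v')
      then Some (Node u' v') else None
  | _ => None
  end.

Fact encode_termK : pcancel encode_term decode_term.
Proof. by elim=> [//|u IHu v IHv] /=; rewrite IHu IHv. Qed.

HB.instance Definition _ := Choice.copy term (pcan_type encode_termK).

(* Boolean form of the least congruence identifying [Node u v] and [Node v u];
   see [commeq_least]. *)
Fixpoint commeq (s t : term) : bool :=
  match s, t with
  | Letter i, Letter j => i == j
  | Node u v, Node u' v' =>
      (commeq u u' && commeq v v') || (commeq u v' && commeq v u')
  | _, _ => false
  end.

Fact commeq_refl : reflexive commeq.
Proof. by elim=> [j|u IHu v IHv] /=; rewrite ?eqxx ?IHu ?IHv. Qed.

Fact commeq_sym : symmetric commeq.
Proof.
elim=> [j|u IHu v IHv] [k|u' v'] //=.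
by rewrite (IHu u') (IHv v') (IHu v') (IHv u') (andbC (commeq v' u)).
Qed.

Fact commeq_trans : transitive commeq.
Proof.
move=> t s; elim: s t => [i|u IHu v IHv] [j|u1 v1] [k|u2 v2] //=.
  by move=> /eqP-> /eqP->.
move=> /orP[]/andP[h1 h2] /orP[]/andP[h3 h4];
  by rewrite (IHu _ _ h1 h3) (IHv _ _ h2 h4) ?orbT
  || by rewrite (IHu _ _ h1 h4) (IHv _ _ h2 h3) ?orbT.
Qed.

Lemma commeq_least (r : term -> term -> Prop) :
    (forall t, r t t) -> (forall s t u, r s t -> r t u -> r s u) ->
    (forall u v, r (Node u v) (Node v u)) ->
    (forall u u' v v', r u u' -> r v v' -> r (Node u v) (Node u' v')) ->
  forall s t, commeq s t -> r s t.
Proof.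
move=> rr rt rC rN; elim=> [i|u IHu v IHv] [j|u' v'] //=; first by move/eqP->.
move=> /orP[]/andP[/IHu ru /IHv rv]; first exact: rN.
exact: rt (rN _ _ _ _ ru rv) (rC _ _).
Qed.

Canonical commeq_equiv :=
  EquivRel commeq commeq_refl commeq_sym commeq_trans.

Definition monomial := {eq_quot commeq_equiv}.
HB.instance Definition _ := Choice.on monomial.
HB.instance Definition _ := EqQuotient.on monomial.

Definition mletter (j : letter) : monomial := \pi_monomial (Letter j).
Definition mmulc (u v : monomial) : monomial :=
  \pi_monomial (Node (repr u) (repr v)).

Lemma commeq_repr (t : term) : commeq (repr (\pi_monomial t)) t.
Proof.
have : repr (\pi_monomial t) == t %[mod monomial] by rewrite reprK.
by rewrite eqmodE.
Qed.

Lemma mmulc_pi (s t : term) :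
  mmulc (\pi_monomial s) (\pi_monomial t) = \pi_monomial (Node s t).
Proof.
by apply/eqmodP; rewrite /= !commeq_repr.
Qed.

Lemma mmulcC : commutative mmulc.
Proof. by move=> u v; apply/eqmodP; rewrite /= !commeq_refl orbT. Qed.

Lemma monomial_ind (P : monomial -> Prop) :
    (forall j, P (mletter j)) ->
    (forall u v, P u -> P v -> P (mmulc u v)) ->
  forall w, P w.
Proof.
move=> Pl Pm w; rewrite -[w]reprK; elim: (repr w) => [j|u Pu v Pv]; first exact: Pl.
by rewrite -mmulc_pi; apply: Pm.
Qed.

Section UniversalProperty.
Context {X : Type} (f : letter -> X) (op : X -> X -> X).

Fixpoint term_fold (t : term) : X :=
  match t with
  | Letter j => f j
  | Node u v => op (term_fold u) (term_fold v)
  end.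

(* When [op] is commutative, the unique morphism of magmas extending [f]. *)
Definition monomial_fold (w : monomial) : X := term_fold (repr w).

Context (opC : commutative op).

Lemma term_fold_commeq s t : commeq s t -> term_fold s = term_fold t.
Proof.
elim: s t => [i|u IHu v IHv] [j|u' v'] //=; first by move/eqP->.
by move=> /orP[]/andP[/IHu-> /IHv->].
Qed.

Lemma monomial_fold_letter j : monomial_fold (mletter j) = f j.
Proof. exact: (term_fold_commeq (commeq_repr (Letter j))). Qed.

Lemma monomial_fold_mul u v :
  monomial_fold (mmulc u v) = op (monomial_fold u) (monomial_fold v).
Proof. exact: (term_fold_commeq (commeq_repr (Node _ _))). Qed.

Lemma monomial_fold_unique (h : monomial -> X) :
    (forall j, h (mletter j) = f j) ->
    (forall u v, h (mmulc u v) = op (h u) (h v)) ->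
  h =1 monomial_fold.
Proof.
move=> hl hm; elim/monomial_ind => [j|u v IHu IHv].
  by rewrite hl monomial_fold_letter.
by rewrite hm IHu IHv monomial_fold_mul.
Qed.

End UniversalProperty.

(* Finitely supported functions from monomials to [K]; the product is [namul]
   below ([monalg] only provides one for associative unital monomials). *)
Notation freeAlg K := {malg K[monomial]}.

Section FreeAlgebra.
Context (K : fieldType).

Definition mono (w : monomial) : freeAlg K := << 1 *g w >>.

Lemma monoZ (a : K) w : a *: mono w = << a *g w >>.
Proof. by apply/malgP => k; rewrite mcoeffZ /mono !mcoeffU mulrnAr mulr1. Qed.

Section LinearExtension.
Context {V : lmodType K} (f : monomial -> V).

Definition linext (g : freeAlg K) : V := \sum_(w <- msupp g) g@_w *: f w.

Lemma linextEw (d : {fset monomial}) g : (msupp g `<=` d)%fset ->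
  linext g = \sum_(w <- d) g@_w *: f w.
Proof.
move=> le_gd; apply: big_fset_incl => // w _ /mcoeff_outdom ->.
by rewrite scale0r.
Qed.

Fact linext_is_linear : linear linext.
Proof.
move=> a g h; set d := (msupp g `|` msupp h)%fset.
have hs : (msupp (a *: g + h) `<=` d)%fset.
  apply: (fsubset_trans (msuppD_le _ _)).
  by apply: fsetUSS => //; apply: msuppZ_le.
rewrite (linextEw hs) (linextEw (fsubsetUl _ (msupp h)))
  (linextEw (fsubsetUr (msupp g) _)) scaler_sumr -big_split /=.
apply: eq_bigr => w _.
by rewrite raddfD /= mcoeffZ scalerDl scalerA.
Qed.
HB.instance Definition _ :=
  GRing.isLinear.Build K (freeAlg K) V *:%R linext linext_is_linear.

Lemma linext_mono w : linext (mono w) = f w.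
Proof.
by rewrite /linext msuppU oner_eq0 big_seq_fset1 mcoeffUU scale1r.
Qed.

Lemma linext_unique (h : {linear freeAlg K -> V}) :
  (forall w, h (mono w) = f w) -> h =1 linext.
Proof.
move=> hf g; rewrite {1}[g]monalgE raddf_sum; apply: eq_bigr => w _ /=.
rewrite -hf -linearZ; by rewrite monoZ.
Qed.

End LinearExtension.

Definition namul (g h : freeAlg K) : freeAlg K :=
  linext (fun u => linext (fun v => mono (mmulc u v)) h) g.

Lemma namul_mono u v : namul (mono u) (mono v) = mono (mmulc u v).
Proof. by rewrite /namul !linext_mono. Qed.

Lemma namulC : commutative namul.
Proof.
move=> g h; rewrite /namul /linext.
under eq_bigr do rewrite scaler_sumr.
rewrite exchange_big; apply: eq_bigr => v _; rewrite scaler_sumr.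
by apply: eq_bigr => u _; rewrite !scalerA mulrC mmulcC.
Qed.

Lemma namul_linearl h : linear (namul^~ h).
Proof. by move=> a g g'; rewrite /namul linearP. Qed.

Definition partial_mono (i : letter) : monomial -> {poly K} :=
  monomial_fold (fun j => (j == i)%:R) (fun a b => 'X * (a + b)).

Definition partial (i : letter) : freeAlg K -> {poly K} :=
  linext (partial_mono i).
HB.instance Definition _ i := GRing.Linear.on (partial i).

Lemma partial_letter i j : partial i (mono (mletter j)) = (j == i)%:R.
Proof.
rewrite /partial linext_mono /partial_mono monomial_fold_letter //.
by move=> a b; rewrite addrC.
Qed.

Lemma partial_mul i u v :
  partial i (namul (mono u) (mono v))
    = 'X * (partial i (mono u) + partial i (mono v)).
Proof.
rewrite namul_mono /partial !linext_mono /partial_mono monomial_fold_mul //.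
by move=> a b; rewrite addrC.
Qed.

Lemma partial_unique i (d : {linear freeAlg K -> {poly K}}) :
    (forall j, d (mono (mletter j)) = (j == i)%:R) ->
    (forall u v, d (namul (mono u) (mono v)) = 'X * (d (mono u) + d (mono v))) ->
  d =1 partial i.
Proof.
move=> dl dm; apply: linext_unique => w.
have <- : partial i (mono w) = partial_mono i w by exact: linext_mono.
elim/monomial_ind: w => [j|u v IHu IHv]; first by rewrite dl partial_letter.
by rewrite -namul_mono dm IHu IHv partial_mul.
Qed.

End FreeAlgebra.

Section Graphs.
Context {V : finType} (e : rel V).

Definition simple_path (x y : V) (p : seq V) : bool :=
  [&& path e x p, last x p == y & uniq (x :: p)].

Definition degree (x : V) : nat := #|[set y | e x y]|.

(* In a rooted tree whose root does not have degree 1, the vertices without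
   children are those of degree at most 1. *)
Definition leaf (x : V) : bool := (degree x <= 1)%N.

Lemma simple_path_ex x y : connect e x y -> exists p, simple_path x y p.
Proof.
move=> /connectP[p /shortenP[q eq uq _] ->].
by exists q; rewrite /simple_path eq uq eqxx.
Qed.

End Graphs.

(* [label] is the labelling of the leaves, a partial function on vertices. *)
Record lrbtree := LRBTree {
  vertex :> finType;
  adj : rel vertex;
  troot : vertex;
  label : vertex -> option letter;
  adj_sym : symmetric adj;
  adj_irr : irreflexive adj;
  adj_connected : forall x y, connect adj x y;
  adj_acyclic : forall x y p q,
    simple_path adj x y p -> simple_path adj x y q -> p = q;
  root_degree : degree adj troot \in [:: 0; 2]%N;
  inner_degree : forall x, x != troot -> degree adj x \in [:: 1; 3]%N;
  label_leaf : forall x, isSome (label x) = leaf adj x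
}.
Arguments adj {T} : rename.
Arguments troot {T} : rename.
Arguments label {T} : rename.

(* The (unique) simple path from [s] to the root, without its origin [s]: its
   size is the number of its edges. *)
Definition path_to_root (T : lrbtree) (s : T) : seq T :=
  xchoose (simple_path_ex (adj_connected s troot)).

Definition height (T : lrbtree) (s : T) : nat := size (path_to_root s).

Definition leaves_labelled (T : lrbtree) (i : letter) : {set T} :=
  [set s : T | leaf adj s & label s == Some i].

Definition tree_iso (T T' : lrbtree) : Prop :=
  exists f : T -> T',
    [/\ bijective f, forall x y, adj (f x) (f y) = adj x y,
        f troot = troot & forall x, label (f x) = label x].

Lemma tree_iso_refl T : tree_iso T T.
Proof. by exists id; split=> //; exists id. Qed.

Lemma tree_iso_sym T T' : tree_iso T T' -> tree_iso T' T.
Proof.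
case=> f [[g fK gK] fa fr fl]; exists g; split; first by exists f.
- by move=> x y; rewrite -fa !gK.
- by rewrite -fr fK.
- by move=> x; rewrite -fl gK.
Qed.

Lemma tree_iso_trans T2 T1 T3 :
  tree_iso T1 T2 -> tree_iso T2 T3 -> tree_iso T1 T3.
Proof.
case=> f [bf fa fr fl] [g [bg ga gr gl]]; exists (g \o f); split=> /=.
- exact: bij_comp.
- by move=> x y; rewrite ga fa.
- by rewrite fr gr.
- by move=> x; rewrite gl fl.
Qed.

Section SingleVertex.
Context (j : letter).

Let e : rel unit := fun _ _ => false.

Fact single_degree x : degree e x = 0%N.
Proof. by apply/eqP; rewrite cards_eq0; apply/eqP/setP=> y; rewrite !inE. Qed.

Fact single_acyclic x y p q :
  simple_path e x y p -> simple_path e x y q -> p = q.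
Proof. by case: p q => [|? ?] [|? ?]. Qed.

Fact single_connected x y : connect e x y.
Proof. by case: x; case: y; apply: connect0. Qed.

Fact single_root_degree : degree e tt \in [:: 0; 2]%N.
Proof. by rewrite single_degree. Qed.

Fact single_inner_degree x : x != tt -> degree e x \in [:: 1; 3]%N.
Proof. by case: x. Qed.

Fact single_label x : isSome (Some j) = leaf e x.
Proof. by rewrite /leaf single_degree. Qed.

Definition single : lrbtree :=
  @LRBTree unit e tt (fun _ => Some j) (fun _ _ => erefl) (fun _ => erefl)
    single_connected single_acyclic single_root_degree single_inner_degree
    single_label.

End SingleVertex.

(* Paths out of a subgraph [f : V -> W] which is only linked to the rest of
   the graph by an edge from [f r] to [c]. *)
Lemma path_branch (V W : finType) (e : rel V) (g : rel W) (f : V -> W) r c :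
    (forall x w, g (f x) w ->
       (exists2 y, w = f y & e x y) \/ (w = c /\ x = r)) ->
  forall x p, path g (f x) p ->
    (exists2 q, p = map f q & path e x q) \/
    (exists q p', [/\ p = map f q ++ c :: p', path e x q, last x q = r
                    & path g c p']).
Proof.
move=> gf x p; elim: p x => [|w p IHp] x /=; first by left; exists [::].
move=> /andP[/gf[[y -> exy]|[-> ->]] gp]; last first.
  by right; exists [::], p.
case: (IHp _ gp) => [[q -> eq]|[q [p' [-> eq lq gp']]]].
  by left; exists (y :: q); rewrite //= exy.
by right; exists (y :: q), p'; rewrite /= exy.
Qed.

Section Grafting.
Context (T1 T2 : lrbtree).

Let V := option (T1 + T2).
Let L (x : T1) : V := Some (inl x).
Let R (x : T2) : V := Some (inr x).

(* [None] is the new root. *)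
Definition graft_adj : rel V := fun x y =>
  match x, y with
  | Some (inl x), Some (inl y) => adj x y
  | Some (inr x), Some (inr y) => adj x y
  | None, Some (inl y) => y == troot
  | None, Some (inr y) => y == troot
  | Some (inl x), None => x == troot
  | Some (inr x), None => x == troot
  | _, _ => false
  end.

Definition graft_label (x : V) : option letter :=
  match x with
  | Some (inl x) => label x
  | Some (inr x) => label x
  | None => None
  end.

Let g := graft_adj.

Fact graft_sym : symmetric g.
Proof. by case=> [[x|x]|] [[y|y]|] //=; rewrite adj_sym. Qed.

Fact graft_irr : irreflexive g.
Proof. by case=> [[x|x]|] //=; rewrite adj_irr. Qed.

Let LI : injective L. Proof. by move=> x y []. Qed.
Let RI : injective R. Proof. by move=> x y []. Qed.

Fact graft_connected x y : connect g x y.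
Proof.
have homL u v : connect adj u v -> connect g (L u) (L v).
  move=> /connectP[p ep ->]; apply/connectP; exists (map L p).
    by rewrite path_map.
  by rewrite last_map.
have homR u v : connect adj u v -> connect g (R u) (R v).
  move=> /connectP[p ep ->]; apply/connectP; exists (map R p).
    by rewrite path_map.
  by rewrite last_map.
have gs : connect_sym g by apply: sym_connect_sym; apply: graft_sym.
have cN z : connect g None z.
  case: z => [[z|z]|]; last exact: connect0.
  - apply: connect_trans (connect1 (_ : g None (L troot))) _; first exact: eqxx.
    exact/homL/adj_connected.
  - apply: connect_trans (connect1 (_ : g None (R troot))) _; first exact: eqxx.
    exact/homR/adj_connected.
by apply: connect_trans (cN y); rewrite gs.
Qed.

Let gL x w : g (L x) w ->
  (exists2 y, w = L y & adj x y) \/ (w = None /\ x = troot).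
Proof.
by case: w => [[y|y]|] //= h; [left; exists y | right; rewrite (eqP h)].
Qed.

Let gR x w : g (R x) w ->
  (exists2 y, w = R y & adj x y) \/ (w = None /\ x = troot).
Proof.
by case: w => [[y|y]|] //= h; [left; exists y | right; rewrite (eqP h)].
Qed.

Let pathN p : path g None p -> None \notin p ->
  [\/ p = [::], exists2 q, p = map L (troot :: q) & path adj troot q
    | exists2 q, p = map R (troot :: q) & path adj troot q].
Proof.
case: p => [|[[y|y]|] p] //=; first by constructor.
- move=> /andP[/eqP-> gp]; rewrite inE negb_or => /andP[_ Np]; constructor 2.
  case: (path_branch gL gp) Np => [[q -> eq]|[q [p' [-> _ _ _]]]].
    by exists q.
  by rewrite mem_cat inE eqxx orbT.
- move=> /andP[/eqP-> gp]; rewrite inE negb_or => /andP[_ Np]; constructor 3.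
  case: (path_branch gR gp) Np => [[q -> eq]|[q [p' [-> _ _ _]]]].
    by exists q.
  by rewrite mem_cat inE eqxx orbT.
Qed.

Let pathL x y p : simple_path g (L x) y p ->
  [\/ exists q z, [/\ p = map L q, y = L z & simple_path adj x z q],
      exists q, [/\ p = rcons (map L q) None, y = None
                  & simple_path adj x troot q]
    | exists q q' z, [/\ p = map L q ++ None :: map R (troot :: q'), y = R z,
                 simple_path adj x troot q & simple_path adj troot z q']].
Proof.
move=> /and3P[gp /eqP yE up].
case: (path_branch gL gp) => [[q pE eq]|[q [p' [pE eq lq gp']]]]; subst p.
  constructor 1; exists q, (last x q); rewrite -yE last_map; split=> //.
  by rewrite /simple_path eq eqxx -(map_inj_uniq LI).
move: up; rewrite -cat_cons cat_uniq => /and3P[uq].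
rewrite /= negb_or => /andP[_ dis] /andP[Np' up'].
have uq' : uniq (x :: q) by rewrite -(map_inj_uniq LI).
have sq : simple_path adj x troot q by rewrite /simple_path eq lq eqxx uq'.
case: (pathN gp' Np') => [p'E|[q' p'E _]|[q' p'E eq']]; subst p'.
- constructor 2; exists q; rewrite cats1; split=> //.
  by rewrite -yE last_cat.
- case/negP: dis; apply/orP; left.
  by rewrite -lq -[_ :: _]/(map L (x :: q)) map_f ?mem_last.
- constructor 3; exists q, q', (last troot q'); split=> //.
    by rewrite -yE last_cat /= last_map.
  by rewrite /simple_path eq' eqxx -(map_inj_uniq RI).
Qed.

Let pathR x y p : simple_path g (R x) y p ->
  [\/ exists q z, [/\ p = map R q, y = R z & simple_path adj x z q],
      exists q, [/\ p = rcons (map R q) None, y = None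
                  & simple_path adj x troot q]
    | exists q q' z, [/\ p = map R q ++ None :: map L (troot :: q'), y = L z,
                 simple_path adj x troot q & simple_path adj troot z q']].
Proof.
move=> /and3P[gp /eqP yE up].
case: (path_branch gR gp) => [[q pE eq]|[q [p' [pE eq lq gp']]]]; subst p.
  constructor 1; exists q, (last x q); rewrite -yE last_map; split=> //.
  by rewrite /simple_path eq eqxx -(map_inj_uniq RI).
move: up; rewrite -cat_cons cat_uniq => /and3P[uq].
rewrite /= negb_or => /andP[_ dis] /andP[Np' up'].
have uq' : uniq (x :: q) by rewrite -(map_inj_uniq RI).
have sq : simple_path adj x troot q by rewrite /simple_path eq lq eqxx uq'.
case: (pathN gp' Np') => [p'E|[q' p'E eq']|[q' p'E _]]; subst p'.
- constructor 2; exists q; rewrite cats1; split=> //.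
  by rewrite -yE last_cat.
- constructor 3; exists q, q', (last troot q'); split=> //.
    by rewrite -yE last_cat /= last_map.
  by rewrite /simple_path eq' eqxx -(map_inj_uniq LI).
- case/negP: dis; apply/orP; left.
  by rewrite -lq -[_ :: _]/(map R (x :: q)) map_f ?mem_last.
Qed.

Fact graft_acyclic x y p q :
  simple_path g x y p -> simple_path g x y q -> p = q.
Proof.
case: x => [[x|x]|].
- move=> /pathL[[p1 [z [-> -> s1]]]|[p1 [-> -> s1]]|[p1 [p2 [z [-> -> s1 s2]]]]];
  move=> /pathL[[q1 [z' [-> // [zE] t1]]]|[q1 [-> // _ t1]]
    |[q1 [q2 [z' [-> // [zE] t1 t2]]]]]; try subst z'.
  + by rewrite (adj_acyclic s1 t1).
  + by rewrite (adj_acyclic s1 t1).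
  + by rewrite (adj_acyclic s1 t1) (adj_acyclic s2 t2).
- move=> /pathR[[p1 [z [-> -> s1]]]|[p1 [-> -> s1]]|[p1 [p2 [z [-> -> s1 s2]]]]];
  move=> /pathR[[q1 [z' [-> // [zE] t1]]]|[q1 [-> // _ t1]]
    |[q1 [q2 [z' [-> // [zE] t1 t2]]]]]; try subst z'.
  + by rewrite (adj_acyclic s1 t1).
  + by rewrite (adj_acyclic s1 t1).
  + by rewrite (adj_acyclic s1 t1) (adj_acyclic s2 t2).
- move=> /and3P[gp /eqP<- /= /andP[Np up]] /and3P[gq /eqP + /= /andP[Nq uq]].
  case: (pathN gp Np) => [?|[p1 ? ep]|[p1 ? ep]];
  case: (pathN gq Nq) => [?|[q1 ? eq]|[q1 ? eq]]; subst p q; rewrite //= !last_map //.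
  + case=> lE; congr (_ :: map L _).
    apply: (@adj_acyclic _ troot (last troot p1)); rewrite /simple_path.
      by rewrite ep eqxx -(map_inj_uniq LI).
    by rewrite eq lE eqxx -(map_inj_uniq LI).
  + case=> lE; congr (_ :: map R _).
    apply: (@adj_acyclic _ troot (last troot p1)); rewrite /simple_path.
      by rewrite ep eqxx -(map_inj_uniq RI).
    by rewrite eq lE eqxx -(map_inj_uniq RI).
Qed.

Fact graft_degreeN : degree g None = 2%N.
Proof.
rewrite /degree (_ : [set y | _] = [set L troot; R troot]) ?cards2 //.
by apply/setP=> [[[y|y]|]]; rewrite !inE /= /L /R ?orbF.
Qed.

Fact graft_degreeL x : degree g (L x) = (degree adj x + (x == troot))%N.
Proof.
rewrite /degree (cardsD1 None) inE /= addnC; congr (_ + _)%N.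
rewrite -(card_imset _ LI); congr #|pred_of_set _|; apply/setP=> [[[y|y]|]].
- by rewrite (mem_imset _ _ LI) !inE.
- by rewrite !inE /=; apply/esym/imsetP=> [[z _]].
- by rewrite !inE /=; apply/esym/imsetP=> [[z _]].
Qed.

Fact graft_degreeR x : degree g (R x) = (degree adj x + (x == troot))%N.
Proof.
rewrite /degree (cardsD1 None) inE /= addnC; congr (_ + _)%N.
rewrite -(card_imset _ RI); congr #|pred_of_set _|; apply/setP=> [[[y|y]|]].
- by rewrite !inE /=; apply/esym/imsetP=> [[z _]].
- by rewrite (mem_imset _ _ RI) !inE.
- by rewrite !inE /=; apply/esym/imsetP=> [[z _]].
Qed.

Fact graft_root_degree : degree g None \in [:: 0; 2]%N.
Proof. by rewrite graft_degreeN. Qed.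

Let degree_cases (T : lrbtree) (x : T) :
  (degree adj x + (x == troot))%N \in [:: 1; 3]%N.
Proof.
have [->|/inner_degree] := eqVneq x troot; last by rewrite addn0.
by have := root_degree T; rewrite !inE => /orP[]/eqP->.
Qed.

Fact graft_inner_degree x : x != None -> degree g x \in [:: 1; 3]%N.
Proof.
by case: x => [[x|x]|] // _; rewrite ?graft_degreeL ?graft_degreeR degree_cases.
Qed.

Let leaf_cases (T : lrbtree) (x : T) :
  isSome (label x) = (degree adj x + (x == troot) <= 1)%N.
Proof.
rewrite label_leaf /leaf; have [->|] := eqVneq x troot; last by rewrite addn0.
by have := root_degree T; rewrite !inE => /orP[]/eqP->.
Qed.

Fact graft_label_leaf x : isSome (graft_label x) = leaf g x.
Proof.
rewrite /leaf; case: x => [[x|x]|] /=; last by rewrite graft_degreeN.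
- by rewrite graft_degreeL leaf_cases.
- by rewrite graft_degreeR leaf_cases.
Qed.

Definition graft : lrbtree :=
  @LRBTree V g None graft_label graft_sym graft_irr graft_connected
    graft_acyclic graft_root_degree graft_inner_degree graft_label_leaf.

End Grafting.

Lemma graft_iso T1 T2 T1' T2' :
  tree_iso T1 T1' -> tree_iso T2 T2' -> tree_iso (graft T1 T2) (graft T1' T2').
Proof.
case=> f [[f' fK f'K] fa fr fl] [h [[h' hK h'K] ha hr hl]].
exists (fun x : graft T1 T2 => match x with
  | Some (inl x) => Some (inl (f x)) | Some (inr x) => Some (inr (h x))
  | None => None end : graft T1' T2').
split=> //.
- exists (fun x : graft T1' T2' => match x with
    | Some (inl x) => Some (inl (f' x)) | Some (inr x) => Some (inr (h' x))
    | None => None end : graft T1 T2).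
  + by case=> [[x|x]|] //; rewrite ?fK ?hK.
  + by case=> [[x|x]|] //; rewrite ?f'K ?h'K.
- have fr' x : (f x == troot) = (x == troot) by rewrite -fr (can_eq fK).
  have hr' x : (h x == troot) = (x == troot) by rewrite -hr (can_eq hK).
  by case=> [[x|x]|] [[y|y]|] /=; rewrite ?fa ?ha ?fr' ?hr'.
- by case=> [[x|x]|] /=.
Qed.

Lemma graft_isoC T1 T2 : tree_iso (graft T1 T2) (graft T2 T1).
Proof.
pose sw T T' (x : graft T T') : graft T' T := match x with
  | Some (inl x) => Some (inr x) | Some (inr x) => Some (inl x)
  | None => None end.
exists (sw T1 T2); split=> //.
- by exists (sw T2 T1); case=> [[x|x]|].
- by case=> [[x|x]|] [[y|y]|].
- by case=> [[x|x]|].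
Qed.

Definition Psi_repr (w : monomial) : lrbtree :=
  term_fold single graft (repr w).

(* Psi(w) as an isomorphism class: [Psi w T] means that T is in this class. *)
Definition Psi (w : monomial) (T : lrbtree) : Prop := tree_iso T (Psi_repr w).

Lemma term_fold_iso s t :
  commeq s t -> tree_iso (term_fold single graft s) (term_fold single graft t).
Proof.
pose r s t := tree_iso (term_fold single graft s) (term_fold single graft t).
apply: (@commeq_least r) => [u|u v w|u v|u u' v v'].
- exact: tree_iso_refl.
- exact: tree_iso_trans.
- exact: graft_isoC.
- exact: graft_iso.
Qed.

Lemma Psi_letter j T : Psi (mletter j) T <-> tree_iso T (single j).
Proof.
have h := term_fold_iso (commeq_repr (Letter j)).
split=> hT; first exact: tree_iso_trans hT h.
exact: tree_iso_trans hT (tree_iso_sym h).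
Qed.

Lemma Psi_mul u v T1 T2 T : Psi u T1 -> Psi v T2 ->
  Psi (mmulc u v) T <-> tree_iso T (graft T1 T2).
Proof.
move=> h1 h2; have h := term_fold_iso (commeq_repr (Node (repr u) (repr v))).
have h' : tree_iso (Psi_repr (mmulc u v)) (graft T1 T2).
  by apply: tree_iso_trans h _; apply: graft_iso; apply: tree_iso_sym.
split=> hT; first exact: tree_iso_trans hT h'.
exact: tree_iso_trans hT (tree_iso_sym h').
Qed.

Lemma Psi_ex w : exists T, Psi w T.
Proof. by exists (Psi_repr w); apply: tree_iso_refl. Qed.

(* Main.v *)
Require Import Defs.
From mathcomp Require Import all_boot all_order all_algebra.

Import GRing.Theory.

Local Open Scope ring_scope.

(* The recursive definition of [partial] matches grafting: each leaf of [T1] or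
   [T2] becomes a leaf of [graft T1 T2] whose height has grown by one, so the
   height sum of [graft T1 T2] is ['X] times the sum of those of [T1] and [T2].
   Since the height sum is invariant under isomorphism, induction on a term
   representing [w] concludes. *)

Lemma path_to_rootP (T : lrbtree) (s : T) :
  simple_path adj s troot (path_to_root s).
Proof. exact: xchooseP. Qed.

(** Simple paths in a tree are unique, so any explicit one replaces the path chosen by [xchoose]. *)
Lemma height_simple_path (T : lrbtree) (s : T) p :
  simple_path adj s troot p -> height s = size p.
Proof. by move=> sp; rewrite /height (adj_acyclic (path_to_rootP T s) sp). Qed.

Lemma simple_path_map (V W : finType) (e : rel V) (g : rel W) (f : V -> W) :
    injective f -> (forall x y, g (f x) (f y) = e x y) ->
  forall x y p, simple_path g (f x) (f y) (map f p) = simple_path e x y p.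
Proof.
move=> fI fg x y p; rewrite /simple_path last_map (inj_eq fI).
by rewrite -map_cons (map_inj_uniq fI) path_map (eq_path fg).
Qed.

Lemma simple_path_rcons (V : finType) (e : rel V) x y z p :
    simple_path e x y p -> e y z -> z \notin x :: p ->
  simple_path e x z (rcons p z).
Proof.
move=> /and3P[ep /eqP lp up] eyz zp; apply/and3P; split.
- by rewrite rcons_path ep lp.
- by rewrite last_rcons.
- by rewrite -rcons_cons rcons_uniq zp.
Qed.

Lemma leaves_labelledE (T : lrbtree) (i : letter) (s : T) :
  (s \in leaves_labelled T i) = (label s == Some i).
Proof.
by rewrite inE -label_leaf andbC; case: eqP => // ->.
Qed.

Lemma big_option (R : nmodType) (I : finType) (F : option I -> R) :
  \sum_x F x = F None + \sum_x F (Some x).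
Proof.
by rewrite ![index_enum _]unlock [@Finite.enum in LHS]unlock /= big_cons big_map.
Qed.

(** Filtering by label alone suffices, since only leaves carry a label. *)
Definition height_sum (K : fieldType) (i : letter) (T : lrbtree) : {poly K} :=
  \sum_(s : T | label s == Some i) 'X^(height s).

Section HeightSum.
Context (K : fieldType) (i : letter).

Lemma height_sum_iso (T T' : lrbtree) :
  tree_iso T T' -> height_sum K i T = height_sum K i T'.
Proof.
case=> f [fB fa fr fl]; rewrite /height_sum (reindex f) /=; last exact: onW_bij.
apply: eq_big => [s|s _]; first by rewrite fl.
rewrite (height_simple_path _ (f s) (map f (path_to_root s))) ?size_map //.
(* The target root becomes [f troot], so the whole path is an image under [f]. *)
rewrite -[X in simple_path _ _ X _]fr (simple_path_map _ _ _ _ f (bij_inj fB) fa).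
exact: path_to_rootP.
Qed.

Lemma height_sum_single j : height_sum K i (single j) = (j == i)%:R.
Proof.
rewrite /height_sum big_mkcond (big_pred1 (tt : single j)); last by case.
(* The only vertex is the root: its path is empty and contributes ['X^0]. *)
rewrite (height_simple_path (single j) tt [::]) //= expr0 (inj_eq Some_inj).
by case: eqP.
Qed.

(** The path from [s] to the root of [T1] is prolonged by one edge to the new root [None]. *)
Lemma height_graftL (T1 T2 : lrbtree) (s : T1) :
  height (Some (inl s) : graft T1 T2) = (height s).+1.
Proof.
pose L x : graft T1 T2 := Some (inl x).
rewrite (height_simple_path _ (L s) (rcons (map L (path_to_root s)) None)).
  by rewrite size_rcons size_map.
apply: (@simple_path_rcons _ _ _ (L troot)) => //=.
- by rewrite (simple_path_map _ _ adj) ?path_to_rootP // => x y [].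
- by apply/negP; rewrite -map_cons => /mapP[].
Qed.

Lemma height_graftR (T1 T2 : lrbtree) (s : T2) :
  height (Some (inr s) : graft T1 T2) = (height s).+1.
Proof.
pose R x : graft T1 T2 := Some (inr x).
rewrite (height_simple_path _ (R s) (rcons (map R (path_to_root s)) None)).
  by rewrite size_rcons size_map.
apply: (@simple_path_rcons _ _ _ (R troot)) => //=.
- by rewrite (simple_path_map _ _ adj) ?path_to_rootP // => x y [].
- by apply/negP; rewrite -map_cons => /mapP[].
Qed.

Lemma height_sum_graft (T1 T2 : lrbtree) :
  height_sum K i (graft T1 T2) = 'X * (height_sum K i T1 + height_sum K i T2).
Proof.
(* The new root has no label, so its term is 0; the other vertices split between [T1] and [T2]. *)
rewrite /height_sum mulrDr !mulr_sumr big_mkcond big_option add0r /=.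
rewrite big_sumType /=; congr (_ + _); rewrite [RHS]big_mkcond /=;
  apply: eq_bigr => s _; case: ifP => // _.
- by rewrite height_graftL exprS.
- by rewrite height_graftR exprS.
Qed.

End HeightSum.

Theorem proposition24 (K : fieldType) (charK : 2%N \notin [pchar K])
    (w : monomial) (i : letter) (T : lrbtree) (wT : Psi w T) :
  partial i (mono K w) = \sum_(s in leaves_labelled T i) 'X^(height s).
Proof.
under eq_bigl do rewrite leaves_labelledE.
rewrite -/(height_sum K i T) (height_sum_iso K i _ _ wT) /partial linext_mono.
rewrite /partial_mono /monomial_fold /Psi_repr.
(* Both sides now come from a [term_fold] over the same [repr w]. Induction on this term, rather
   than on monomials, makes the tree of a product literally a [graft], not merely isomorphic to
   one. *)
elim: (repr w) => [j|u IHu v IHv] /=; first by rewrite height_sum_single.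
by rewrite height_sum_graft IHu IHv.
Qed.
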